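(* For every field $K$, every $n\ge1$, every integer $r\ge0$ and every $\varepsilon\in[0,1]$: $\mathcal{R}_{H_n}(r)\le \varepsilon\cdot 2^{2n}$ over $K$ if and only if the $\varepsilon$-probabilistic rank of $H_n$ over $K$ is at most $r$.
   Context: $H_n$ is the $2^n\times2^n$ matrix indexed by $\{0,1\}^n\times\{0,1\}^n$ with $H_n(u,v)=(-1)^{\langle u,v\rangle}$, $\langle u,v\rangle=\sum_k u_kv_k$, viewed over $K$. For a matrix $A$ over $K$, $\mathcal{R}_A(r)$ (rigidity over $K$) is the minimum number of entries of $A$ that must be changed so that the result has rank at most $r$ over $K$. A probabilistic matrix over $K$ is a probability distribution $\mathcal{M}$ on $N\times N$ matrices over $K$; it has rank at most $r$ if every matrix in its support has rank at most $r$; it computes an $N\times N$ matrix $A$ with error $\varepsilon$ if for every entry $(i,j)$, $\Pr_{B\sim\mathcal{M}}[B_{ij}=A_{ij}]\ge 1-\varepsilon$. The $\varepsilon$-probabilistic rank of $A$ over $K$ is the minimum $r$ such that some probabilistic matrix of rank at most $r$ computes $A$ with error $\varepsilon$. *)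

(* Defs.v *)
From mathcomp Require Import all_boot all_order all_algebra.
From mathcomp Require Import boolp classical_sets reals ereal esum.

Set Implicit Arguments.
Unset Strict Implicit.
Unset Printing Implicit Defensive.
Import Order.TTheory GRing.Theory Num.Theory.
Local Open Scope classical_set_scope.
Local Open Scope ring_scope.

(* MathComp matrices have ordinal indices, so {0,1}^n is represented by
   {ffun 'I_n -> bool} and a row or column index i stands for the vector
   enum_val i. *)
Definition cube (n : nat) : finType := {ffun 'I_n -> bool}.

Lemma card_cube n : #|cube n| = (2 ^ n)%N.
Proof. by rewrite card_ffun card_bool card_ord. Qed.

Definition dotb n (u v : cube n) : nat := (\sum_(k < n) u k * v k)%N.

Definition hadamard (K : fieldType) n : 'M[K]_#|cube n| :=
  \matrix_(i, j) (-1) ^+ dotb (enum_val i) (enum_val j).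

Section Rigidity.
Variables (K : fieldType) (p q : nat).
Implicit Types A B : 'M[K]_(p, q).

Definition mxdist A B : nat :=
  #|[pred ij : 'I_p * 'I_q | A ij.1 ij.2 != B ij.1 ij.2]|.

Definition low_rank_at A (r s : nat) : Prop :=
  exists B, (\rank B <= r)%N /\ mxdist A B = s.

Lemma low_rank_at_ex A r : exists s, `[< low_rank_at A r s >].
Proof.
by exists (mxdist A 0); apply/asboolP; exists 0; rewrite mxrank0.
Qed.

Definition rigidity A r : nat := ex_minn (low_rank_at_ex A r).

End Rigidity.

(* A discrete distribution, given by its mass function; the support may be
   infinite. *)
Record prob_matrix (R : realType) (K : fieldType) (N : nat) := ProbMatrix {
  mass :> 'M[K]_N -> R;
  mass_ge0 : forall B, 0 <= mass B;
  mass_sum1 : \esum_(B in [set: 'M[K]_N]) (mass B)%:E = 1%E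
}.

Section ProbabilisticRank.
Variables (R : realType) (K : fieldType) (N : nat).
Implicit Types (M : prob_matrix R K N) (A B : 'M[K]_N) (eps : R).

Definition prob M (E : set 'M[K]_N) : \bar R := \esum_(B in E) (M B)%:E.

Definition support M : set 'M[K]_N := [set B | 0 < M B].

Definition rank_at_most M (r : nat) : Prop :=
  forall B, support M B -> (\rank B <= r)%N.

Definition computes M A eps : Prop :=
  forall i j, ((1 - eps)%:E <= prob M [set B | B i j = A i j])%E.

Definition prob_computable A eps (r : nat) : Prop :=
  exists M, rank_at_most M r /\ computes M A eps.

Lemma point_mass_ge0 A B : 0 <= (B == A)%:R :> R.
Proof. exact: ler0n. Qed.

Lemma point_mass_sum A (E : set 'M[K]_N) : E A ->
  \esum_(B in E) ((B == A)%:R%:E : \bar R) = 1%E.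
Proof.
move=> EA; have -> : 1%E = \esum_(B in [set A]) ((B == A)%:R%:E : \bar R).
  by rewrite esum_set1 eqxx // lee_fin ler01.
rewrite [LHS]esum_mkcond [RHS]esum_mkcond; apply: eq_esum => B _.
case: (eqVneq B A) => [->|nBA]; first by rewrite !mem_set.
by rewrite !if_same.
Qed.

Definition point_mass A : prob_matrix R K N :=
  ProbMatrix (point_mass_ge0 A) (point_mass_sum (I : [set: 'M[K]_N] A)).

Lemma prob_computable_ex A eps : 0 <= eps ->
  exists r, `[< prob_computable A eps r >].
Proof.
move=> eps_ge0; exists N; apply/asboolP; exists (point_mass A); split.
  by move=> B _; exact: rank_leq_row.
move=> i j; rewrite /prob /= point_mass_sum //.
by rewrite lee_fin lerBlDr lerDl.
Qed.

(* For eps < 0 no probabilistic matrix computes A with error eps when N > 0,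
   hence the argument eps_ge0. *)
Definition prob_rank A eps (eps_ge0 : 0 <= eps) : nat :=
  ex_minn (prob_computable_ex A eps_ge0).

End ProbabilisticRank.

(* Main.v *)
Require Import Defs.
From mathcomp Require Import all_boot all_order all_algebra reals.
From mathcomp Require Import boolp classical_sets ereal esum.

Set Implicit Arguments.
Unset Strict Implicit.
Unset Printing Implicit Defensive.
Import Order.TTheory GRing.Theory Num.Theory.
Local Open Scope ring_scope.

(** If a random matrix of rank at most [r] computes [A], every matrix in its
    support differs from [A] in at least [rigidity A r] entries, while the
    expected number of differences is at most [eps] times the number of
    entries. Conversely, bilinearity of the inner product gives
    [H(u + a, v + b) = H(u, v) * H(u, b) * H(a, v) * H(a, b)], so shifting a
    low-rank [B] by [(a, b)] and rescaling its rows and columns by signs turns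
    its error set for [H] into the shifted error set. A uniformly random shift
    spreads the errors evenly over all entries. *)

(** The matrix is [B] multiplied by selection matrices and then by diagonal ones, and no product
    raises the rank. *)
Lemma rank_scaled_mxsub (K : fieldType) (m n p q : nat) (B : 'M[K]_(m, n))
    (s : 'I_p -> K) (t : 'I_q -> K) (f : 'I_p -> 'I_m) (g : 'I_q -> 'I_n) :
  (\rank (\matrix_(i, j) (s i * t j * B (f i) (g j)))%R <= \rank B)%N.
Proof.
have -> : \matrix_(i, j) (s i * t j * B (f i) (g j)) =
    diag_mx (\row_i s i) *m rowsub f (colsub g B) *m diag_mx (\row_j t j).
  by apply/matrixP => i j; rewrite mul_mx_diag mul_diag_mx !mxE mulrAC.
apply: leq_trans (mxrankM_maxl _ _) _; apply: leq_trans (mxrankM_maxr _ _) _.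
rewrite rowsubE; apply: leq_trans (mxrankM_maxr _ _) _.
by rewrite -mxrank_tr trmx_mxsub rowsubE -[leqRHS]mxrank_tr mxrankM_maxr.
Qed.

Section Hadamard.
Variables (K : fieldType) (n : nat).
Implicit Types (u v a b : cube n) (B : 'M[K]_#|cube n|).

Lemma sign_dotb_xorl u a v :
  (-1) ^+ dotb [ffun k => u k (+) a k] v =
  (-1) ^+ dotb u v * (-1) ^+ dotb a v :> K.
Proof.
rewrite /dotb -!prodrXr -big_split; apply: eq_bigr => k _ /=.
by rewrite ffunE; case: (u k) (a k) (v k) => [] [] [];
  rewrite /= ?mulr1 ?mul1r ?mulrNN ?mulr1.
Qed.

Lemma dotbC u v : dotb u v = dotb v u.
Proof. by apply: eq_bigr => k _; rewrite mulnC. Qed.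

Lemma sign_dotb_xorr u v b :
  (-1) ^+ dotb u [ffun k => v k (+) b k] =
  (-1) ^+ dotb u v * (-1) ^+ dotb u b :> K.
Proof. by rewrite dotbC sign_dotb_xorl !(dotbC u). Qed.

Definition shift a (i : 'I_#|cube n|) : 'I_#|cube n| :=
  enum_rank ([ffun k => enum_val i k (+) a k] : cube n).

(** Injectivity is in the shift [a], with the index [i] fixed: a uniform shift then moves [i] to a
    uniform index. *)
Lemma shift_inj (i : 'I_#|cube n|) : injective (fun a => shift a i).
Proof.
move=> a b /enum_rank_inj /ffunP ab; apply/ffunP => k.
by move: (ab k); rewrite !ffunE => /addbI.
Qed.

(** The sign depending only on [ab] is grouped with the column sign, so that the entries have the
    form [s i * t j * B _ _] of [rank_scaled_mxsub]. *)
Definition shifted_mx B (ab : cube n * cube n) : 'M[K]_#|cube n| :=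
  \matrix_(i, j) ((-1) ^+ dotb (enum_val i) ab.2 *
    ((-1) ^+ dotb ab.1 (enum_val j) * (-1) ^+ dotb ab.1 ab.2) *
    B (shift ab.1 i) (shift ab.2 j)).

Lemma shifted_mx_eq B ab i j :
  (shifted_mx B ab i j == hadamard K n i j) =
  (B (shift ab.1 i) (shift ab.2 j) ==
   hadamard K n (shift ab.1 i) (shift ab.2 j)).
Proof.
case: ab => a b; rewrite !mxE !enum_rankK /= sign_dotb_xorl !sign_dotb_xorr.
set w := _ ^+ dotb (enum_val i) (enum_val j).
(* [s] is the sign relating the shifted entry of the Hadamard matrix to [w]; as its own inverse, it
   can cross the equation. *)
set s := _ ^+ _ * (_ * _).
have ss : s * s = 1 by rewrite -expr2 /s -!exprD sqrr_sign.
rewrite -mulrA -/s (mulrC w).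
by apply/eqP/eqP => [<-|->]; rewrite mulrA ss mul1r.
Qed.

(** For fixed [i] and [j], sending a pair of shifts to the shifted position is an injection between
    sets of equal size, hence a bijection. *)
Lemma card_shifted_agree B i j :
  #|[pred ab | shifted_mx B ab i j == hadamard K n i j]| =
  #|[pred ij : 'I_#|cube n| * 'I_#|cube n| |
      hadamard K n ij.1 ij.2 == B ij.1 ij.2]|.
Proof.
pose h (ab : cube n * cube n) := (shift ab.1 i, shift ab.2 j).
have h_inj : injective h.
  by move=> [a b] [a' b'] [] /shift_inj -> /shift_inj ->.
rewrite -sum1_card -[RHS]sum1_card [RHS](reindex h) /=; last first.
  by apply: onW_bij; apply: inj_card_bij; rewrite // !card_prod !card_ord.
by apply: eq_bigl => ab; rewrite !inE shifted_mx_eq eq_sym.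
Qed.

End Hadamard.

Lemma mxdist_agree (K : fieldType) (p q : nat) (A B : 'M[K]_(p, q)) :
  (#|[pred ij : 'I_p * 'I_q | A ij.1 ij.2 == B ij.1 ij.2]| + mxdist A B =
   p * q)%N.
Proof.
rewrite -[in RHS](card_ord p) -[in RHS](card_ord q) -card_prod.
by rewrite -[RHS](cardC [pred ij | A ij.1 ij.2 == B ij.1 ij.2]).
Qed.

Section Uniform.
Variables (R : realType) (K : fieldType) (N : nat) (T : finType).
Variables (T_gt0 : (0 < #|T|)%N) (f : T -> 'M[K]_N).

(** Summing over [t] adds up the weights when [f] takes the same value several times. *)
Definition uniform_mass (B : 'M[K]_N) : R :=
  \sum_t (B == f t)%:R / #|T|%:R.

Lemma uniform_mass_ge0 B : 0 <= uniform_mass B.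
Proof. by apply: sumr_ge0 => t _; rewrite divr_ge0 ?ler0n. Qed.

Lemma esum_pointwise (E : set 'M[K]_N) A (c : R) : 0 <= c ->
  \esum_(B in E) ((B == A)%:R * c)%:E = (`[< E A >]%:R * c)%:E.
Proof.
move=> c_ge0.
(* Only [B = A] can contribute; once extended by zero, the sums over [E] and over the singleton
   agree termwise. *)
have <- : \esum_(B in [set A]%classic) (`[< E B >]%:R * c)%:E =
    (`[< E A >]%:R * c)%:E.
  by rewrite esum_set1 // lee_fin mulr_ge0 ?ler0n.
rewrite esum_mkcond [RHS]esum_mkcond; apply: eq_esum => B _.
case: (eqVneq B A) => [->|nBA].
  rewrite [A \in [set A]%classic]mem_set // mul1r.
  have [EA|nEA] := asboolP (E A); first by rewrite mem_set // mul1r.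
  by rewrite memNset // mul0r.
by rewrite mul0r if_same memNset //; apply/eqP.
Qed.

Lemma esum_uniform_mass (E : set 'M[K]_N) :
  \esum_(B in E) (uniform_mass B)%:E =
  (#|[pred t | `[< E (f t) >]]|%:R / #|T|%:R)%:E.
Proof.
have inv_ge0 : 0 <= (#|T|%:R)^-1 :> R by rewrite invr_ge0 ler0n.
under eq_esum do rewrite -sumEFin.
rewrite esum_sum => [|B t _ _]; last by rewrite lee_fin mulr_ge0 ?ler0n.
under eq_bigr do rewrite esum_pointwise //.
rewrite sumEFin -mulr_suml -natr_sum; congr (_%:R / _)%:E.
rewrite -sum1_card [RHS]big_mkcond /=.
by apply: eq_bigr => t _; rewrite inE; case: asboolP.
Qed.

Lemma uniform_mass_sum1 :
  \esum_(B in [set: 'M[K]_N]%classic) (uniform_mass B)%:E = 1%E.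
Proof.
rewrite esum_uniform_mass.
rewrite (@eq_card _ _ T) => [|t]; last by rewrite !inE; apply/asboolP.
by rewrite divff // pnatr_eq0 -lt0n.
Qed.

Definition uniform_matrix : prob_matrix R K N :=
  ProbMatrix uniform_mass_ge0 uniform_mass_sum1.

Lemma support_uniform_matrix B :
  Defs.support uniform_matrix B -> exists t, B = f t.
Proof.
rewrite /Defs.support /= => B_gt0; apply: contrapT => nB.
suff B0 : uniform_mass B = 0 by rewrite B0 ltxx in B_gt0.
apply: big1 => t _; case: eqP => [Bt|_]; last by rewrite mul0r.
by case: nB; exists t.
Qed.

End Uniform.

Lemma rigidity_le_mxdist (K : fieldType) (p q : nat) (A B : 'M[K]_(p, q)) r :
  (\rank B <= r)%N -> (rigidity A r <= mxdist A B)%N.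
Proof.
move=> rB; rewrite /rigidity; case: ex_minnP => s _; apply.
by apply/asboolP; exists B.
Qed.

Lemma rigidity_attained (K : fieldType) (p q : nat) (A : 'M[K]_(p, q)) r :
  exists B, (\rank B <= r)%N /\ mxdist A B = rigidity A r.
Proof. by rewrite /rigidity; case: ex_minnP => s /asboolP. Qed.

Lemma prob_rank_leP (R : realType) (K : fieldType) N (A : 'M[K]_N) (eps : R)
    (eps_ge0 : 0 <= eps) r :
  (prob_rank A eps_ge0 <= r)%N <-> prob_computable A eps r.
Proof.
rewrite /prob_rank; case: ex_minnP => s /asboolP[M [rM cM]] smin; split.
  by move=> sr; exists M; split=> // B /rM /leq_trans; apply.
by move=> Ar; apply: smin; apply/asboolP.
Qed.

Lemma rigidity_le_prob_computable (R : realType) (K : fieldType) N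
    (A : 'M[K]_N) (eps : R) r :
  prob_computable A eps r -> (rigidity A r)%:R <= eps * (N * N)%:R.
Proof.
move=> [M [rM cM]]; pose rig := rigidity A r.
(* Comparison with the zero matrix; this keeps the natural subtraction below from truncating. *)
have rig_le : (rig <= N * N)%N.
  have := @rigidity_le_mxdist _ _ _ A 0 r; rewrite mxrank0 => /(_ isT).
  by move/leq_trans; apply; rewrite -(mxdist_agree A 0) leq_addl.
(* The expected number of agreements, bounded after exchanging the two sums. *)
have agree_le : (\sum_(ij : 'I_N * 'I_N) prob M [set B | B ij.1 ij.2 = A ij.1 ij.2]%classic
    <= (N * N - rig)%:R%:E)%E.
  rewrite /prob; under eq_bigr do rewrite esum_mkcond.
  rewrite -esum_sum => [|B ij _ _]; last by case: ifP; rewrite // lee_fin mass_ge0.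
  (* The bound becomes that many copies of the total mass, so both sides can be compared matrix by
     matrix. *)
  have -> : ((N * N - rig)%:R%:E =
      \esum_(B in [set: 'M[K]_N]) \sum_(k < N * N - rig) (M B)%:E)%E.
    rewrite esum_sum => [|B k _ _]; last by rewrite lee_fin mass_ge0.
    under eq_bigr do rewrite mass_sum1.
    by rewrite sumEFin sumr_const card_ord.
  apply: le_esum => B _; rewrite [leRHS]sumEFin sumr_const card_ord.
  rewrite -big_mkcond /= sumEFin sumr_const lee_fin.
  (* The rank bound is known only on the support; elsewhere both sides vanish. *)
  have [MB0|MB_neq0] := eqVneq (M B) 0; first by rewrite MB0 !mul0rn.
  have MB : 0 < M B by rewrite lt_neqAle eq_sym MB_neq0 mass_ge0.
  rewrite -[leLHS]mulr_natr -[leRHS]mulr_natr ler_pM2l // ler_nat.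
  rewrite leq_subRL // addnC -(mxdist_agree A B).
  apply: leq_add (rigidity_le_mxdist _ (rM _ MB)).
  apply/subset_leq_card/fintype.subsetP => ij; rewrite !inE.
  by move->.
have : (\sum_(ij : 'I_N * 'I_N) (1 - eps)%:E <= (N * N - rig)%:R%:E)%E.
  by apply: le_trans agree_le; apply: lee_sum => ij _; apply: cM.
rewrite sumEFin sumr_const card_prod card_ord lee_fin natrB //.
by rewrite -[leLHS]mulr_natr mulrBl mul1r lerD2l lerN2.
Qed.

Lemma hadamard_prob_computable (R : realType) (K : fieldType) n (eps : R) r :
  (rigidity (hadamard K n) r)%:R <= eps * (#|cube n| * #|cube n|)%:R ->
  prob_computable (hadamard K n) eps r.
Proof.
have [B [rB <-]] := rigidity_attained (hadamard K n) r => Beps.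
have T_gt0 : (0 < #|{: cube n * cube n}|)%N.
  by rewrite card_prod !card_cube muln_gt0 expn_gt0.
exists (uniform_matrix R T_gt0 (shifted_mx B)); split.
  move=> _ /support_uniform_matrix[ab ->]; apply: leq_trans rB.
  exact: rank_scaled_mxsub.
move=> i j; rewrite /prob esum_uniform_mass lee_fin.
rewrite ler_pdivlMr ?ltr0n // mulrBl mul1r lerBlDr card_prod.
(* All positions split into agreements, as many as the good shifts, and differences, bounded by
   [Beps]. *)
rewrite -{1}(mxdist_agree (hadamard K n) B) natrD.
rewrite -(card_shifted_agree _ i j); apply: lerD => //.
rewrite ler_nat; apply/subset_leq_card/fintype.subsetP => ab.
by rewrite !inE => /eqP.
Qed.

Theorem theorem1p5 (R : realType) (K : fieldType) (n : nat) (n_gt0 : (0 < n)%N)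
    (r : nat) (eps : R) (eps_ge0 : 0 <= eps) (eps_le1 : eps <= 1) :
  (rigidity (hadamard K n) r)%:R <= eps * 2 ^+ (2 * n) <->
  (prob_rank (hadamard K n) eps_ge0 <= r)%N.
Proof.
have -> : 2 ^+ (2 * n) = (#|cube n| * #|cube n|)%:R :> R.
  by rewrite card_cube natrM natrX mul2n -addnn exprD.
split=> [|/prob_rank_leP]; last exact: rigidity_le_prob_computable.
by move=> ?; apply/prob_rank_leP; apply: hadamard_prob_computable.
Qed.
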